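(* Let $I=(v_1,v_2,D)$ be an HN ideal of $A$. Suppose that $x_1,x_2,x_3$ is a regular sequence and that $\operatorname{grade}(v)=2$. Then $I$ is geometrically linked to $(u)$, i.e., $(u)=(v):I$, $I=(v):(u)$ and $I\cap(u)=(v)$.
   Context: $A$ is a commutative Noetherian ring with identity and $x_1,x_2,x_3\in A$ generate a proper ideal of height $3$. $a=(a_1,a_2,a_3)$ and $b=(b_1,b_2,b_3)$ are triples of positive integers, and $c=a+b=(c_1,c_2,c_3)$. Put $v_1=x_1^{c_1}-x_2^{b_2}x_3^{a_3}$, $v_2=x_2^{c_2}-x_1^{a_1}x_3^{b_3}$, $D=x_3^{c_3}-x_1^{b_1}x_2^{a_2}$, $u_1=x_1^{a_1}$, $u_2=-x_2^{b_2}$, and write $(v)=(v_1,v_2)$, $(u)=(u_1,u_2)$. The ideal $I=(v_1,v_2,D)$ is called an HN (Herzog-Northcott) ideal. The grade of an ideal is the maximal length of a regular sequence on $A$ contained in it. *)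

(* Defs.v *)
From mathcomp Require Import all_boot all_order all_algebra.
From mathcomp Require Import boolp classical_sets.

Set Implicit Arguments.
Unset Strict Implicit.
Unset Printing Implicit Defensive.

Import GRing.Theory.
Local Open Scope classical_set_scope.
Local Open Scope ring_scope.

Definition is_max (S : set nat) (n : nat) : Prop := S n /\ ubound S n.
Definition is_min (S : set nat) (n : nat) : Prop := S n /\ lbound S n.

Section CommutativeAlgebra.
Variable A : comNzRingType.

(* Subsets of A are Prop-valued, since ideal membership is not decidable.
   [idealr_closed] includes properness, so general ideals (possibly all of A)
   are the submodules of the regular module A^o. *)
Definition is_ideal (I : set A) : Prop :=
  GRing.submod_closed (mem I : {pred A^o}).

Definition is_prime_ideal (P : set A) : Prop :=
  idealr_closed (mem P) /\ prime_idealr_closed (mem P).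

Definition ideal_gen (s : seq A) : set A :=
  [set x | exists k : 'I_(size s) -> A, x = \sum_(i < size s) k i * s`_i].

Definition noetherian : Prop :=
  forall I : set A, is_ideal I -> exists s : seq A, I = ideal_gen s.

Definition colon (I J : set A) : set A :=
  [set x | forall y, J y -> I (x * y)].

(* The sequence is ordered: s`_i is a nonzerodivisor modulo s`_0, ..., s`_i.-1,
   and A / (s) is nonzero. *)
Definition regular_seq (s : seq A) : Prop :=
  (forall i, (i < size s)%N -> forall y : A,
     ideal_gen (take i s) (s`_i * y) -> ideal_gen (take i s) y) /\
  ~ ideal_gen s 1.

Definition has_grade (I : set A) (n : nat) : Prop :=
  is_max [set m | exists s : seq A,
    [/\ size s = m, [set` s] `<=` I & regular_seq s]] n.

(* p 0 `<` p 1 `<` ... `<` p n = P; the values of p beyond n are irrelevant. *)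
Definition prime_chain (P : set A) (n : nat) (p : nat -> set A) : Prop :=
  [/\ forall i, (i <= n)%N -> is_prime_ideal (p i),
      forall i, (i < n)%N -> p i `<` p i.+1
    & p n = P].

Definition has_prime_height (P : set A) (n : nat) : Prop :=
  is_max [set m | exists p, prime_chain P m p] n.

(* A prime of infinite height has no [has_prime_height], so it does not
   contribute to the minimum. *)
Definition has_height (I : set A) (n : nat) : Prop :=
  is_min [set m | exists P,
    [/\ is_prime_ideal P, I `<=` P & has_prime_height P m]] n.

Definition geometrically_linked (V I J : set A) : Prop :=
  [/\ J = colon V I, I = colon V J & I `&` J = V].

End CommutativeAlgebra.

(* Main.v *)
Require Import Defs.
From mathcomp Require Import all_boot all_order all_algebra.
From mathcomp Require Import boolp classical_sets.
From mathcomp Require Import ring.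

Import GRing.Theory.
Local Open Scope classical_set_scope.
Local Open Scope ring_scope.

(** Write [v = M u] with [D = det M], so that [D u] lies in [(v)] by Cramer's
    rule.  Grade 2 makes the Koszul complex of [v] exact even when [v] itself is
    not a regular sequence, and that of [u] is exact because [u] consists of
    powers of [x1, x2].  Comparing coefficients of the relations gives
    [(v) : (u) = (v, D)], while [(v) : D] is contained in [(u)] because [x3] is
    a nonzerodivisor modulo [(u)].  Since [D] is a power of [x3] up to a
    nilpotent modulo [(u)], it is a nonzerodivisor there too, whence
    [(v, D)] and [(u)] meet in [(v)]. *)

(** * Ideals with at most three generators as explicit combinations *)

Section IdealGen.
Variable A : comNzRingType.
Implicit Types x y z p q : A.

Lemma ideal_gen_nil y : ideal_gen [::] y <-> y = 0.
Proof.
split=> [[k ->]|->]; first by rewrite big_ord0.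
by exists (fun=> 0); rewrite big_ord0.
Qed.

Lemma ideal_gen_cons x (s : seq A) y :
  ideal_gen (x :: s) y <-> exists p, ideal_gen s (y - p * x).
Proof.
split=> [[k ->]|[p [k yE]]].
  exists (k ord0); rewrite big_ord_recl /= addrC addKr.
  by exists (fun i => k (lift ord0 i)).
(* The family with [p] at index 0, followed by [k] shifted by one. *)
exists (fun i => oapp k p (unlift ord0 i)).
rewrite big_ord_recl unlift_none /= -[LHS](subrK (p * x)) yE addrC.
by congr (_ + _); apply: eq_bigr => i _; rewrite liftK.
Qed.

Lemma ideal_gen1 x y : ideal_gen [:: x] y <-> exists p, y = p * x.
Proof.
rewrite ideal_gen_cons; split=> -[p].
  by rewrite ideal_gen_nil => /subr0_eq; exists p.
by move=> ->; exists p; rewrite ideal_gen_nil subrr.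
Qed.

Lemma ideal_gen2 x1 x2 y :
  ideal_gen [:: x1; x2] y <-> exists p q, y = p * x1 + q * x2.
Proof.
rewrite ideal_gen_cons; split=> [[p]|[p [q ->]]].
  rewrite ideal_gen1 => -[q yE].
  by exists p, q; rewrite -yE addrC subrK.
by exists p; rewrite ideal_gen1; exists q; rewrite addrC addKr.
Qed.

Lemma ideal_gen3 x1 x2 x3 y :
  ideal_gen [:: x1; x2; x3] y <->
  exists p q r, y = p * x1 + q * x2 + r * x3.
Proof.
rewrite ideal_gen_cons; split=> [[p]|[p [q [r ->]]]].
  rewrite ideal_gen2 => -[q [r yE]].
  by exists p, q, r; rewrite -addrA -yE addrC subrK.
by exists p; rewrite ideal_gen2; exists q, r; ring.
Qed.

End IdealGen.

(** * Nonzerodivisors modulo powers, and Koszul relations *)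

Section Regularity.
Variable A : comNzRingType.
Implicit Types x y z p q r s t u v : A.

(** [J] may be all of [A], so inductions on an exponent can start at 0. *)
Definition nzd_mod (J : set A) x := forall y, J (x * y) -> J y.

Lemma nzd_modX (J : set A) x n : nzd_mod J x -> nzd_mod J (x ^+ n).
Proof.
move=> xP; elim: n => [|n IHn] y; first by rewrite expr0 mul1r.
by rewrite exprS -mulrA => /xP/IHn.
Qed.

Lemma nzd_modN (s : seq A) x : nzd_mod (ideal_gen s) x -> nzd_mod (ideal_gen s) (- x).
Proof.
move=> xP y [k yE]; apply: xP; exists (fun i => - k i).
by rewrite -[LHS]opprK -mulNr yE -sumrN; apply: eq_bigr => i _; rewrite mulNr.
Qed.

Lemma nzd_mod0_lreg x : nzd_mod (ideal_gen [::]) x -> GRing.lreg x.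
Proof.
move=> xP y z /eqP; rewrite -subr_eq0 -mulrBr => /eqP/ideal_gen_nil/xP.
by move/ideal_gen_nil/subr0_eq.
Qed.

Lemma regular_seq2 x1 x2 : regular_seq [:: x1; x2] ->
  GRing.lreg x1 /\ nzd_mod (ideal_gen [:: x1]) x2.
Proof.
by case=> reg _; split; [exact: nzd_mod0_lreg (reg 0 isT)|exact: reg 1 isT].
Qed.

Lemma regular_seq3 x1 x2 x3 : regular_seq [:: x1; x2; x3] ->
  [/\ GRing.lreg x1, nzd_mod (ideal_gen [:: x1]) x2
    & nzd_mod (ideal_gen [:: x1; x2]) x3].
Proof.
by case=> reg _; split;
  [exact: nzd_mod0_lreg (reg 0 isT)|exact: reg 1 isT|exact: reg 2 isT].
Qed.

(** From [x1 * y = p * x2], regularity of [x2] modulo [x1] gives [p = q * x1]; cancelling [x1]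
    leaves [y = q * x2]. *)
Lemma nzd_mod_swap x1 x2 :
  GRing.lreg x1 -> nzd_mod (ideal_gen [:: x1]) x2 ->
  nzd_mod (ideal_gen [:: x2]) x1.
Proof.
move=> reg1 reg2 y /ideal_gen1[p yE].
have /reg2/ideal_gen1[q pE] : ideal_gen [:: x1] (x2 * p).
  by apply/ideal_gen1; exists y; rewrite mulrC -yE mulrC.
by apply/ideal_gen1; exists q; apply: reg1; rewrite yE pE; ring.
Qed.

Lemma nzd_mod_expl x1 x2 n :
  GRing.lreg x1 -> nzd_mod (ideal_gen [:: x1]) x2 ->
  nzd_mod (ideal_gen [:: x1 ^+ n]) x2.
Proof.
move=> reg1 reg2; elim: n => [|n IHn] y.
  by move=> _; apply/ideal_gen1; exists y; rewrite expr0 mulr1.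
move=> /ideal_gen1[p yE].
have /reg2/ideal_gen1[z zE] : ideal_gen [:: x1] (x2 * y).
  by apply/ideal_gen1; exists (p * x1 ^+ n); rewrite yE exprSr mulrA.
have /IHn/ideal_gen1[q qE] : ideal_gen [:: x1 ^+ n] (x2 * z).
  apply/ideal_gen1; exists p; apply: reg1.
  have -> : x1 * (x2 * z) = x2 * (z * x1) by ring.
  by rewrite -zE yE exprS; ring.
by apply/ideal_gen1; exists q; rewrite zE qE exprSr mulrA.
Qed.

Lemma ideal_gen2C x1 x2 : ideal_gen [:: x1; x2] = ideal_gen [:: x2; x1].
Proof.
by apply/seteqP; split=> y /ideal_gen2[p [q ->]];
  apply/ideal_gen2; exists q, p; rewrite addrC.
Qed.

(** Induction on [n]: if [x3 * y] lies in [(x1, x2 ^+ n.+1)], then [y = p' * x1 + y' * x2], and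
    cancelling [x2] modulo [x1] puts [x3 * y'] in [(x1, x2 ^+ n)]. *)
Lemma nzd_mod_expr2 x1 x2 x3 n :
  nzd_mod (ideal_gen [:: x1]) x2 -> nzd_mod (ideal_gen [:: x1; x2]) x3 ->
  nzd_mod (ideal_gen [:: x1; x2 ^+ n]) x3.
Proof.
move=> reg2 reg3; elim: n => [|n IHn] y.
  by move=> _; apply/ideal_gen2; exists 0, y; rewrite expr0; ring.
move=> /ideal_gen2[p [q yE]].
have /reg3/ideal_gen2[p' [y' y'E]] : ideal_gen [:: x1; x2] (x3 * y).
  by apply/ideal_gen2; exists p, (q * x2 ^+ n); rewrite yE exprS; ring.
have /reg2/ideal_gen1[r rE] : ideal_gen [:: x1] (x2 * (x3 * y' - q * x2 ^+ n)).
  apply/ideal_gen1; exists (p - x3 * p').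
  have -> : x2 * (x3 * y' - q * x2 ^+ n)
    = x3 * (p' * x1 + y' * x2) - x3 * p' * x1 - q * x2 ^+ n.+1.
    by rewrite exprS; ring.
  by rewrite -y'E yE; ring.
have /IHn/ideal_gen2[k [l kl]] : ideal_gen [:: x1; x2 ^+ n] (x3 * y').
  by apply/ideal_gen2; exists r, q; rewrite -rE subrK.
by apply/ideal_gen2; exists (p' + k * x2), l; rewrite y'E kl exprS; ring.
Qed.

Lemma nzd_mod_exp2 x1 x2 x3 m n :
  GRing.lreg x1 -> nzd_mod (ideal_gen [:: x1]) x2 ->
  nzd_mod (ideal_gen [:: x1; x2]) x3 ->
  nzd_mod (ideal_gen [:: x1 ^+ m; x2 ^+ n]) x3.
Proof.
move=> reg1 reg2 reg3; apply: nzd_mod_expr2; first exact: nzd_mod_expl.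
(* With the generators exchanged, the same lemma raises [x1] to its power. *)
rewrite ideal_gen2C; apply: nzd_mod_expr2; last by rewrite ideal_gen2C.
exact: nzd_mod_swap.
Qed.

(* Exactness of the Koszul complex of [v1, v2] in degree 1. *)
Definition koszul_exact v1 v2 :=
  forall s t, s * v1 + t * v2 = 0 -> exists r, s = r * v2 /\ t = - (r * v1).

Lemma nzd_koszul_exact u1 u2 :
  GRing.lreg u1 -> nzd_mod (ideal_gen [:: u1]) u2 -> koszul_exact u1 u2.
Proof.
move=> reg1 reg2 s t st.
have /reg2/ideal_gen1[r tE] : ideal_gen [:: u1] (u2 * t).
  apply/ideal_gen1; exists (- s).
  by rewrite mulNr [u2 * t]mulrC; apply/eqP; rewrite -addr_eq0 addrC st.
exists (- r); split; last by rewrite tE; ring.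
apply: reg1; apply/subr0_eq.
by rewrite -[RHS]st tE; ring.
Qed.

Lemma grade2_koszul_exact v1 v2 :
  has_grade (ideal_gen [:: v1; v2]) 2 -> koszul_exact v1 v2.
Proof.
case=> -[w [size_w wV regw]] _ s t st.
case: w size_w wV regw => [|w1 [|w2 [|//]]] //= _ wV /regular_seq2[reg1 reg2].
have /wV/ideal_gen2[k1 [l1 w1E]] : [set` [:: w1; w2]] w1.
  by rewrite /= mem_head.
have /wV/ideal_gen2[k2 [l2 w2E]] : [set` [:: w1; w2]] w2.
  by rewrite /= !inE eqxx orbT.
(* A relation [s v1 + t v2 = 0] makes [t wi] a multiple [ei v1] of [v1] and
   [s wi] a multiple [- ei v2] of [v2]; the goal is that [w1] divides [e1]. *)
pose e1 := t * k1 - s * l1; pose e2 := t * k2 - s * l2.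
have tw1 : t * w1 = e1 * v1 + l1 * (s * v1 + t * v2) by rewrite w1E /e1; ring.
have sw1 : s * w1 = - (e1 * v2) + k1 * (s * v1 + t * v2).
  by rewrite w1E /e1; ring.
have tw2 : t * w2 = e2 * v1 + l2 * (s * v1 + t * v2) by rewrite w2E /e2; ring.
have sw2 : s * w2 = - (e2 * v2) + k2 * (s * v1 + t * v2).
  by rewrite w2E /e2; ring.
rewrite !(st, mulr0, addr0) in tw1 sw1 tw2 sw2.
(* The element [w2 * e1 - w1 * e2] kills [v1] and [v2], hence also their combination [w1], so it is
   zero; then [w1] divides [e1] because [w2] is regular modulo [w1]. *)
have ann1 : (w2 * e1 - w1 * e2) * v1 = 0.
  have -> : (w2 * e1 - w1 * e2) * v1 = w2 * (e1 * v1) - w1 * (e2 * v1) by ring.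
  by rewrite -tw1 -tw2; ring.
have ann2 : (w2 * e1 - w1 * e2) * v2 = 0.
  have -> : (w2 * e1 - w1 * e2) * v2 = w1 * - (e2 * v2) - w2 * - (e1 * v2).
    by ring.
  by rewrite -sw1 -sw2; ring.
have /subr0_eq we : w2 * e1 - w1 * e2 = 0.
  apply: reg1; rewrite mulr0 {1}w1E.
  set e := _ - _ in ann1 ann2 *.
  have -> : (k1 * v1 + l1 * v2) * e = k1 * (e * v1) + l1 * (e * v2) by ring.
  by rewrite ann1 ann2; ring.
have /reg2/ideal_gen1[r e1E] : ideal_gen [:: w1] (w2 * e1).
  by apply/ideal_gen1; exists e2; rewrite we mulrC.
exists (- r); split; apply: reg1; rewrite mulrC.
  by rewrite sw1 e1E; ring.
by rewrite tw1 e1E; ring.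
Qed.

End Regularity.

(** * Linkage from a two by two matrix *)

Arguments nzd_mod {A}.
Arguments koszul_exact {A}.

Lemma det_linked (A : comNzRingType) (u1 u2 m11 m12 m21 m22 : A) :
  let v1 := m11 * u1 + m12 * u2 in
  let v2 := m21 * u1 + m22 * u2 in
  let D := m11 * m22 - m12 * m21 in
  let U := ideal_gen [:: u1; u2] in
  koszul_exact v1 v2 -> koszul_exact u1 u2 ->
  nzd_mod U m12 -> nzd_mod U D ->
  geometrically_linked (ideal_gen [:: v1; v2]) (ideal_gen [:: v1; v2; D]) U.
Proof.
move=> v1 v2 D U kv ku regm regD.
set V := ideal_gen [:: v1; v2]; set I := ideal_gen [:: v1; v2; D].
have Vv p q : V (p * v1 + q * v2) by apply/ideal_gen2; exists p, q.
have IP p q r : I (p * v1 + q * v2 + r * D).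
  by apply/ideal_gen3; exists p, q, r.
have VU y : V y -> U y.
  case/ideal_gen2=> p [q ->]; apply/ideal_gen2.
  by exists (p * m11 + q * m21), (p * m12 + q * m22); rewrite /v1 /v2; ring.
(* Cramer's rule: [D * u1 = m22 * v1 - m12 * v2] and [D * u2 = m11 * v2 - m21 * v1]. *)
have DU p q y : U y -> V (p * v1 + q * v2 + D * y).
  case/ideal_gen2=> k [l ->]; apply/ideal_gen2.
  exists (p + k * m22 - l * m21), (q - k * m12 + l * m11).
  by rewrite /v1 /v2 /D; ring.
have UM r y : U y -> U (r * y).
  case/ideal_gen2=> k [l ->].
  by apply/ideal_gen2; exists (r * k), (r * l); ring.
have UV : U `<=` colon V I.
  move=> y Uy _ /ideal_gen3[p [q [r ->]]].
  by have := DU (y * p) (y * q) _ (UM r _ Uy); congr V; ring.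
split; apply/seteqP; split=> //.
- move=> y /(_ D) VyD; apply: regm.
  have /ideal_gen2[p [q yD]] : V (y * D).
    by apply: VyD; have := IP 0 0 1; congr I; ring.
  (* Two expressions of [y * D * u1] in [v1, v2] are compared: one from [yD], one from Cramer's
     rule. The coefficient of [v2] then puts [m12 * y] in [U]. *)
  have /kv[r [_ qE]] : (u1 * p - y * m22) * v1 + (u1 * q + y * m12) * v2 = 0.
    rewrite -[RHS](subrr (u1 * (y * D))) {1}yD /v1 /v2 /D; ring.
  apply/ideal_gen2; exists (- q - r * m11), (- (r * m12)).
  have -> : m12 * y = (u1 * q + y * m12) - u1 * q by ring.
  by rewrite qE /v1; ring.
- move=> _ /ideal_gen3[p [q [r ->]]] y Uy.
  by have := DU (p * y) (q * y) _ (UM r _ Uy); congr V; ring.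
- move=> y VyU.
  have /ideal_gen2[p [q yu1]] : V (y * u1).
    by apply: VyU; apply/ideal_gen2; exists 1, 0; ring.
  have /ideal_gen2[p' [q' yu2]] : V (y * u2).
    by apply: VyU; apply/ideal_gen2; exists 0, 1; ring.
  (* Expanding [y * v1] through [y * u1] and [y * u2] gives [y = m11 * p + m12 * p'] modulo [v2]. *)
  have /kv[r [rE _]] :
    (m11 * p + m12 * p' - y) * v1 + (m11 * q + m12 * q') * v2 = 0.
    have -> : (m11 * p + m12 * p' - y) * v1 + (m11 * q + m12 * q') * v2 =
      m11 * (p * v1 + q * v2) + m12 * (p' * v1 + q' * v2) - y * v1 by ring.
    by rewrite -yu1 -yu2 /v1; ring.
  (* Since [u2 * (y * u1) = u1 * (y * u2)], the coefficients of [v1] satisfy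
     [u2 * p - u1 * p' = s * v2]. Writing [v2] in [u1, u2] turns this into a relation on [u], whose
     solution is [p = s * m22 - k * u1], [p' = - s * m21 - k * u2]; the [s] terms add up to
     [s * D]. *)
  have /kv[s [sE _]] : (u2 * p - u1 * p') * v1 + (u2 * q - u1 * q') * v2 = 0.
    have -> : (u2 * p - u1 * p') * v1 + (u2 * q - u1 * q') * v2 =
      u2 * (p * v1 + q * v2) - u1 * (p' * v1 + q' * v2) by ring.
    by rewrite -yu1 -yu2; ring.
  have /ku[k [kE1 kE2]] : (- p' - s * m21) * u1 + (p - s * m22) * u2 = 0.
    have -> : (- p' - s * m21) * u1 + (p - s * m22) * u2 =
      (u2 * p - u1 * p') - s * v2 by rewrite /v2; ring.
    by rewrite sE subrr.
  apply/ideal_gen3; exists (- k), (- r), s.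
  have -> : y = m11 * ((p - s * m22) + s * m22)
    - m12 * ((- p' - s * m21) + s * m21) - (m11 * p + m12 * p' - y) by ring.
  by rewrite rE kE1 kE2 /v1 /D; ring.
- move=> y [/ideal_gen3[p [q [r ->]]] Uy].
  (* As [V] lies in [U], [D * r] is in [U], so [r] is in [U] and Cramer's rule puts [D * r] in
     [V]. *)
  rewrite [r * D]mulrC; apply: DU; apply: regD.
  case/ideal_gen2: Uy => k [l E].
  have /VU/ideal_gen2[k' [l' E']] := Vv p q.
  apply/ideal_gen2; exists (k - k'), (l - l').
  have -> : D * r = (p * v1 + q * v2 + r * D) - (p * v1 + q * v2) by ring.
  by rewrite E E'; ring.
- move=> y Vy; split; last exact: VU.
  case/ideal_gen2: Vy => p [q ->].
  by have := IP p q 0; congr I; ring.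
Qed.

(** * Specialization to HN ideals *)

Lemma ideal_gen2N (A : comNzRingType) (x y : A) :
  ideal_gen [:: x; - y] = ideal_gen [:: x; y].
Proof.
by apply/seteqP; split=> z /ideal_gen2[p [q ->]];
  apply/ideal_gen2; exists p, (- q); ring.
Qed.

(** [d - n] divides [d ^+ m - n ^+ m], which is [d ^+ m] modulo [U]; so whatever [d - n] sends into
    [U], [d ^+ m] does too. *)
Lemma nzd_mod_sub_nil (A : comNzRingType) (u1 u2 d n : A) (m : nat) :
  let U := ideal_gen [:: u1; u2] in
  U (n ^+ m) -> nzd_mod U d -> nzd_mod U (d - n).
Proof.
move=> U /ideal_gen2[k [l nE]] regd y /ideal_gen2[p [q yE]].
apply: (@nzd_modX _ _ _ m regd).
have [z zE] : exists z, d ^+ m - n ^+ m = (d - n) * z.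
  by eexists; exact: subrXX.
apply/ideal_gen2; exists (z * p + k * y), (z * q + l * y).
have -> : d ^+ m * y = (d ^+ m - n ^+ m) * y + n ^+ m * y by ring.
rewrite zE nE; have -> : (d - n) * z * y = z * ((d - n) * y) by ring.
by rewrite yE; ring.
Qed.

Theorem proposition5p2 (A : comNzRingType) (x1 x2 x3 : A)
    (a1 a2 a3 b1 b2 b3 : nat) :
  noetherian A ->
  ~ ideal_gen [:: x1; x2; x3] 1 ->
  has_height (ideal_gen [:: x1; x2; x3]) 3 ->
  (0 < a1)%N -> (0 < a2)%N -> (0 < a3)%N ->
  (0 < b1)%N -> (0 < b2)%N -> (0 < b3)%N ->
  let c1 := (a1 + b1)%N in
  let c2 := (a2 + b2)%N in
  let c3 := (a3 + b3)%N in
  let v1 := x1 ^+ c1 - x2 ^+ b2 * x3 ^+ a3 in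
  let v2 := x2 ^+ c2 - x1 ^+ a1 * x3 ^+ b3 in
  let D := x3 ^+ c3 - x1 ^+ b1 * x2 ^+ a2 in
  let u1 := x1 ^+ a1 in
  let u2 := - x2 ^+ b2 in
  let I := ideal_gen [:: v1; v2; D] in
  let V := ideal_gen [:: v1; v2] in
  let U := ideal_gen [:: u1; u2] in
  regular_seq [:: x1; x2; x3] ->
  has_grade V 2 ->
  geometrically_linked V I U.
Proof.
move=> _ _ _ a1_gt0 _ _ b1_gt0 _ _ c1 c2 c3 v1 v2 D u1 u2 I V U.
move=> /regular_seq3[reg1 reg2 reg3] /grade2_koszul_exact kv.
(* The matrix has rows [(x1 ^+ b1, x3 ^+ a3)] and [(- x3 ^+ b3, - x2 ^+ a2)]. *)
have v1E : v1 = x1 ^+ b1 * u1 + x3 ^+ a3 * u2.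
  by rewrite /v1 /c1 /u1 /u2 exprD; ring.
have v2E : v2 = - x3 ^+ b3 * u1 + - x2 ^+ a2 * u2.
  by rewrite /v2 /c2 /u1 /u2 exprD; ring.
have DE : D = x1 ^+ b1 * - x2 ^+ a2 - x3 ^+ a3 * - x3 ^+ b3.
  by rewrite /D /c3 exprD; ring.
have regU : nzd_mod U x3 by rewrite /U ideal_gen2N; exact: nzd_mod_exp2.
have regD : nzd_mod U D.
  apply: (@nzd_mod_sub_nil _ _ _ _ _ a1); last exact: nzd_modX.
  (* As [b1] is positive, the [a1]-th power of [x1 ^+ b1 * x2 ^+ a2] is a multiple of
     [u1 = x1 ^+ a1]. *)
  apply/ideal_gen2; exists (x1 ^+ (b1.-1 * a1) * x2 ^+ (a2 * a1)), 0.
  rewrite mul0r addr0 exprMn -!exprM mulrAC -exprD.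
  by rewrite addnC -mulSn prednK.
have ku : koszul_exact u1 u2.
  apply: nzd_koszul_exact; first exact: lregX.
  by apply: nzd_modN; apply: nzd_modX; exact: nzd_mod_expl.
rewrite /V /I v1E v2E DE in kv regD *.
apply: det_linked => //; exact: nzd_modX.
Qed.
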